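(* There exist absolute constants $\beta\in(0,1)$ and $c>0$ such that the following holds. Fix $a>0$, $\sigma>0$, let $M=\max(m_1,m_2)$, and let $r$ be an integer such that $1\le r\le\min(m_1,m_2)$ and $Mr\le n$. Let the matrices $X_i$ be i.i.d. uniformly distributed on $\mathcal X$ and let, conditionally on $X_i$, the variables $\xi_i=Y_i-\mathbb E(Y_i\mid X_i)$ be Gaussian $\mathcal N(0,\sigma^2)$, for $i=1,\dots,n$. Then $$\inf_{\hat A}\ \sup_{A_0\in\mathcal A(r,a)}\mathbb P_{A_0}\left(\frac1{m_1m_2}\|\hat A-A_0\|_2^2>c(\sigma\wedge a)^2\,\frac{Mr}{n}\right)\ge\beta .$$
   Context: $(X_i,Y_i)$, $i=1,\dots,n$, are independent random pairs with $\mathbb E(Y_i\mid X_i)=\mathrm{tr}(X_i^\top A_0)$, $A_0\in\mathbb R^{m_1\times m_2}$; $\mathbb P_{A_0}$ denotes the distribution of $(X_1,Y_1,\dots,X_n,Y_n)$. $\mathcal X=\{e_j(m_1)e_k(m_2)^\top:1\le j\le m_1,\,1\le k\le m_2\}$, where $e_k(d)$ are the canonical basis vectors of $\mathbb R^d$. $\|\cdot\|_2$ is the Frobenius norm; $\sigma\wedge a=\min(\sigma,a)$. $\mathcal A(r,a)=\{A_0=(a_0(i,j))\in\mathbb R^{m_1\times m_2}:\mathrm{rank}(A_0)\le r,\ \max_{i,j}|a_0(i,j)|\le a\}$. $\inf_{\hat A}$ is the infimum over all estimators, i.e. measurable functions of $(X_1,Y_1,\dots,X_n,Y_n)$ with values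 in $\mathbb R^{m_1\times m_2}$. *)

(* Defs.v *)
From HB Require Import structures.
From mathcomp Require Import all_boot all_order all_algebra.
From mathcomp Require Import all_classical all_reals all_analysis measurable_realfun.
Set Implicit Arguments.
Unset Strict Implicit.
Unset Printing Implicit Defensive.
Import Order.TTheory GRing.Theory Num.Theory.
Import numFieldNormedType.Exports.
Local Open Scope classical_set_scope.
Local Open Scope ring_scope.

Definition measure_mx_display : measure_display -> measure_display.
Proof. exact. Qed.

Section measurable_matrix.
Context {d} {T : measurableType d} (m n : nat).

(* The sigma-algebra on matrices generated by the entries; over the reals it
   is the Borel sigma-algebra of R^(m x n). *)
Definition mx_entry_preimages : set (set 'M[T]_(m, n)) :=
  \bigcup_(ij in [set: 'I_m * 'I_n])
    preimage_set_system setT (fun A : 'M[T]_(m, n) => A ij.1 ij.2) measurable.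

Let mx_set0 : <<s mx_entry_preimages >> set0.
Proof. exact: sigma_algebra0. Qed.

Let mx_setC A : <<s mx_entry_preimages >> A -> <<s mx_entry_preimages >> (~` A).
Proof. exact: sigma_algebraC. Qed.

Let mx_bigcup (F : (set _)^nat) : (forall i, <<s mx_entry_preimages >> (F i)) ->
  <<s mx_entry_preimages >> (\bigcup_i (F i)).
Proof. exact: sigma_algebra_bigcup. Qed.

HB.instance Definition _ := @isMeasurable.Build (measure_mx_display d)
  'M[T]_(m, n) <<s mx_entry_preimages >> mx_set0 mx_setC mx_bigcup.

Lemma measurable_mx_entry (i : 'I_m) (j : 'I_n) :
  measurable_fun setT (fun A : 'M[T]_(m, n) => A i j).
Proof.
move=> _ Y mY; rewrite setTI; apply: sub_sigma_algebra.
by exists (i, j) => //; exists Y => //; rewrite setTI.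
Qed.

End measurable_matrix.

Section iid.
Context d (T : measurableType d) (R : realType).

Definition tuple_cons n (p : T * n.-tuple T) : n.+1.-tuple T :=
  [tuple of p.1 :: p.2].

Lemma measurable_tuple_cons n : measurable_fun setT (@tuple_cons n).
Proof. exact: measurable_cons. Qed.

HB.instance Definition _ n := @isMeasurableFun.Build _ _ _ _
  (@tuple_cons n) (@measurable_tuple_cons n).

(* The n-fold product Q x ... x Q, i.e. the joint law of n independent
   variables with common law Q (see iid_box). *)
Fixpoint iid (Q : probability T R) (n : nat) : probability (n.-tuple T) R :=
  match n with
  | 0 => \d_[tuple]
  | k.+1 => distribution (Q \x iid Q k)%E (@tuple_cons k)
  end.

Lemma iid_box (Q : probability T R) n (B : 'I_n -> set T) :
  (forall i, measurable (B i)) ->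
  iid Q n [set t | forall i, B i (tnth t i)] = (\prod_(i < n) Q (B i))%E.
Proof.
elim: n B => [|n IHn] B mB /=.
  by rewrite big_ord0 diracE mem_set// => -[].
rewrite big_ord_recl /distribution /pushforward -IHn//.
rewrite -product_measure1E//; last first.
  rewrite (_ : [set t | _] = \bigcap_(i in [set: 'I_n])
    ((fun t : n.-tuple T => tnth t i) @^-1` B (lift ord0 i))); last first.
    by apply/seteqP; split => t /= h i; [move=> _; exact: h|exact: (h i I)].
  apply: fin_bigcap_measurable => // i _; rewrite -[X in measurable X]setTI.
  exact: measurable_tnth.
congr (_ _); apply/seteqP; split => [[x t] /= h|[x t] /= [Bx h] i].
  by split; [exact: (h ord0)|move=> i; have := h (lift ord0 i); rewrite tnthS].
by case: (unliftP ord0 i) => [j ->|->//]; rewrite tnthS.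
Qed.
End iid.

Section trace_regression.
Context {R : realType} (m1 m2 : nat).

Definition canonical_vec m (j : 'I_m) : 'cV[R]_m := delta_mx j ord0.

Definition design_points : set 'M[R]_(m1, m2) :=
  [set canonical_vec jk.1 *m (canonical_vec jk.2)^T |
     jk in [set: 'I_m1 * 'I_m2]].

Lemma finite_design_points : finite_set design_points.
Proof. exact/finite_image/finite_finset. Qed.

Lemma measurable_mx1 (A : 'M[R]_(m1, m2)) : measurable [set A].
Proof.
rewrite (_ : [set A] = \bigcap_(ij in [set: 'I_m1 * 'I_m2])
    ((fun B : 'M[R]_(m1, m2) => B ij.1 ij.2) @^-1` [set A ij.1 ij.2])).
  apply: fin_bigcap_measurable => // -[i j] _.
  by rewrite -[X in measurable X]setTI; exact: measurable_mx_entry.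
apply/seteqP; split => [B /= -> //|B /= h].
by apply/matrixP => i j; exact: (h (i, j)).
Qed.

Lemma measurable_design_points : measurable design_points.
Proof.
rewrite -(image_id design_points) -bigcup_imset1.
apply: fin_bigcup_measurable; first exact: finite_design_points.
by move=> A _; exact: measurable_mx1.
Qed.

(* The second argument of mnormalize is the value taken when the set of design
   points is empty, i.e. when m1 = 0 or m2 = 0. *)
Definition uniform_design : probability 'M[R]_(m1, m2) R :=
  mnormalize (mrestr (@counting _ R) measurable_design_points)
    (dirac (0 : 'M[R]_(m1, m2))).

Lemma uniform_designE (j : 'I_m1) (k : 'I_m2) :
  uniform_design [set canonical_vec j *m (canonical_vec k)^T] =
  ((m1 * m2)%:R^-1)%:E.
Proof.
have e_inj : injective (fun jk : 'I_m1 * 'I_m2 =>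
    canonical_vec jk.1 *m (canonical_vec jk.2)^T).
  move=> [i1 i2] [l1 l2] /= /matrixP/(_ i1 i2).
  rewrite /canonical_vec !trmx_delta !mul_delta_mx !mxE !eqxx /=.
  case: eqP => [->|_]; case: eqP => [->|_] //= /eqP; by rewrite oner_eq0.
have cardX : counting design_points = (m1 * m2)%:R%:E :> \bar R.
  rewrite /counting asboolT; last exact: finite_design_points.
  rewrite /design_points fset_set_image; last exact: finite_finset.
  have -> : (m1 * m2)%N = size (enum {: 'I_m1 * 'I_m2}).
    by rewrite -cardE card_prod !card_ord.
  rewrite (finmap.card_imfset _ _ e_inj) /=.
  congr ((_ : nat)%:R%:E); apply: perm_size.
  apply: uniq_perm; [exact: finmap.fset_uniq|exact: enum_uniq|].
  move=> x; rewrite mem_enum [LHS]in_fset_set; last exact: finite_finset.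
  by apply/idP; rewrite in_setE.
pose mu (U : set 'M[R]_(m1, m2)) : \bar R := counting (U `&` design_points).
rewrite -[LHS]/((if (mu setT == 0)%E || (mu setT == +oo)%E then _
  else fun U => (mu U * ((fine (mu setT))^-1)%:E)%E) _) /mu setTI cardX.
have m_neq0 : (m1 * m2)%:R != 0 :> R.
  by rewrite pnatr_eq0 muln_eq0 negb_or -!lt0n (leq_trans _ (ltn_ord j))//
    (leq_trans _ (ltn_ord k)).
rewrite eqe (negbTE m_neq0) /=.
rewrite (_ : _ `&` _ = [set canonical_vec j *m (canonical_vec k)^T]); last first.
  by apply/seteqP; split => [B []//|B /= ->]; split => //; exists (j, k).
by rewrite /counting asboolT// fset_set1 finmap.cardfs1 mul1e.
Qed.

Definition observe (A0 : 'M[R]_(m1, m2)) (p : 'M[R]_(m1, m2) * measurableTypeR R) :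
    'M[R]_(m1, m2) * R :=
  (p.1, \tr (p.1^T *m A0) + p.2).

Lemma measurable_observe A0 : measurable_fun setT (observe A0).
Proof.
apply/measurable_fun_pairP; split; first exact: measurable_fst.
rewrite (_ : snd \o _ = fun p : 'M[R]_(m1, m2) * measurableTypeR R =>
    \sum_i \sum_j p.1 j i * A0 j i + p.2); last first.
  apply/funext => p /=; congr (_ + _); apply: eq_bigr => i _.
  by rewrite mxE; apply: eq_bigr => j _; rewrite mxE.
apply: measurable_funD; last exact: measurable_snd.
apply: measurable_sum => i; apply: measurable_sum => j.
apply: measurable_funM => //.
exact: (measurableT_comp (@measurable_mx_entry _ R m1 m2 j i) measurable_fst).
Qed.

HB.instance Definition _ A0 := @isMeasurableFun.Build _ _ _ _
  (observe A0) (measurable_observe A0).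

(* X is uniform on the design points, the noise is Gaussian given X (i.e.
   independent of X), and Y = tr (X^T A0) + noise.  The second argument of
   normal_prob is the standard deviation. *)
Definition observation_law (A0 : 'M[R]_(m1, m2)) (sigma : R) :
    probability ('M[R]_(m1, m2) * R)%type R :=
  distribution (uniform_design \x normal_prob 0 sigma)%E (observe A0).

Lemma observation_law_cond A0 sigma (x : 'M[R]_(m1, m2)) (B : set R) :
  measurable B ->
  observation_law A0 sigma
    [set p | p.1 = x /\ B (p.2 - \tr (p.1^T *m A0))] =
  (uniform_design [set x] * normal_prob 0 sigma B)%E.
Proof.
move=> mB; rewrite -product_measure1E//; last exact: measurable_mx1.
rewrite /observation_law /= /distribution /pushforward; congr (_ _).
by apply/seteqP; split => -[y e] /= [->];
  rewrite addrAC subrr add0r.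
Qed.

Definition sample_law A0 sigma n := iid (observation_law A0 sigma) n.

Definition frobenius_norm (A : 'M[R]_(m1, m2)) : R :=
  Num.sqrt (\sum_i \sum_j A i j ^+ 2).

Definition bounded_rank_class (r : nat) (a : R) : set 'M[R]_(m1, m2) :=
  [set A0 | (\rank A0 <= r)%N /\ forall i j, `|A0 i j| <= a].

End trace_regression.

(* Main.v *)
(** Assouad's cube.  Let M = max(m1, m2), gamma = (sigma /\ a) sqrt(M r / n) / 8,
and assume M = m1.  For a sign pattern w on [m1] x [r], let A_w have (i,j)-entry
+-gamma with sign w(i, j mod r); then rank A_w <= r and the entries are bounded
by a.  Flipping one sign changes at most 2 m2 / r entries, which are observed
about 2 n / (M r) times in the sample, so the chi-square divergence between the
two sample laws is bounded.  Every value of an estimated entry is at distance at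
least gamma from its true value under one of the two patterns, so the estimator
misses it by gamma with constant probability under one of them.  Averaging over
entries and patterns gives a pattern under which, with constant probability, a
constant fraction of the entries is missed by at least gamma. *)

Require Import Defs.
From mathcomp Require Import all_boot all_order all_algebra.
From mathcomp Require Import all_classical all_reals all_analysis measurable_realfun.
From mathcomp Require Import ring lra.
Set Implicit Arguments.
Unset Strict Implicit.
Unset Printing Implicit Defensive.
Import Order.TTheory GRing.Theory Num.Theory.
Import numFieldNormedType.Exports.
Local Open Scope classical_set_scope.
Local Open Scope ring_scope.

(** * Chi-square divergence in variational form: scaling, tensorization, comparison of events *)

Section chi2.
Local Open Scope ereal_scope.
Context {R : realType}.

(* For Q with density L with respect to P, this holds iff
   1 + chi2(Q, P) = \int L^2 dP <= K (take f = L for the direct implication).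
   The variational form tensorizes by Tonelli's theorem, without densities. *)
Definition chi2_le d (T : measurableType d) (P Q : {measure set T -> \bar R})
    (K : R) :=
  forall f : T -> \bar R, measurable_fun setT f -> (forall x, 0 <= f x) ->
  2%:E * \int[Q]_x f x <= \int[P]_x (f x * f x) + K%:E.

(** Test the inequality on [t * f]. The free scale [t] is what [chi2_le_sqr] and [chi2_le_prod]
    choose. *)
Lemma chi2_leZ d (T : measurableType d) (P Q : {measure set T -> \bar R})
    (K t : R) (f : T -> \bar R) : chi2_le P Q K ->
  measurable_fun setT f -> (forall x, 0 <= f x) -> (0 <= t)%R ->
  (2 * t)%:E * \int[Q]_x f x <= (t * t)%:E * \int[P]_x (f x * f x) + K%:E.
Proof.
move=> PQ mf f0 t0; have mff := emeasurable_funM mf mf.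
have tf0 x : 0 <= t%:E * f x by exact: mule_ge0.
have := PQ _ (measurable_funeM t%:E mf) tf0.
rewrite ge0_integralZl// muleA -EFinM.
under [X in _ <= X + _ -> _]eq_integral do rewrite muleACA -EFinM.
by rewrite ge0_integralZl// ?lee_fin ?mulr_ge0// => x _; exact: mule_ge0.
Qed.

(** Optimising [chi2_leZ] over the scale turns the affine bound into its Cauchy-Schwarz form. *)
Lemma chi2_le_sqr d (T : measurableType d) (P Q : {measure set T -> \bar R})
    (K : R) (f : T -> \bar R) : chi2_le P Q K -> (0 < K)%R ->
  measurable_fun setT f -> (forall x, 0 <= f x) ->
  (\int[Q]_x f x) * (\int[Q]_x f x) <= K%:E * \int[P]_x (f x * f x).
Proof.
move=> PQ K0 mf f0.
have : forall t : R, (0 <= t)%R ->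
    (2 * t)%:E * \int[Q]_x f x <= (t * t)%:E * \int[P]_x (f x * f x) + K%:E.
  by move=> t; exact: chi2_leZ.
have : 0 <= \int[Q]_x f x by apply: integral_ge0.
have : 0 <= \int[P]_x (f x * f x).
  by apply: integral_ge0 => x _; exact: mule_ge0.
case: (\int[P]_x (f x * f x)) => [A| |]//; last first.
  by move=> _ _ _; rewrite gt0_muley ?lte_fin// leey.
case: (\int[Q]_x f x) => [x| |]//; last first.
  move=> _ _ /(_ 1%R ler01).
  by rewrite !mulr1 gt0_muley ?lte_fin ?ltr0n// mul1e -EFinD leye_eq.
rewrite !lee_fin => A0 x0 H.
have {}H t : (0 <= t -> 2 * t * x <= t * t * A + K)%R.
  by move=> /H; rewrite -!EFinM -EFinD lee_fin.
(* If A = 0 and x > 0, the scale t = K / x would give 2K <= K. *)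
have [A0'|Apos] := eqVneq A 0%R.
  have [->|xN0] := eqVneq x 0%R; first by rewrite A0' !mulr0.
  have := H (K / x)%R (divr_ge0 (ltW K0) x0).
  by rewrite A0' mulr0 add0r mulrA divfK//; lra.
have {}Apos : (0 < A)%R by rewrite lt_neqAle eq_sym Apos.
(* The minimiser of t^2 A - 2 t x + K is t = x / A. *)
have := H (x / A)%R (divr_ge0 x0 A0).
rewrite -(ler_pM2r Apos).
have -> : ((2 * (x / A) * x) * A = 2 * (x * x))%R by field; rewrite gt_eqF.
have -> : ((x / A * (x / A) * A + K) * A = x * x + K * A)%R.
  by field; rewrite gt_eqF.
lra.
Qed.

(** Let g integrate f over the second factor under [Q2], and h integrate f^2 there under [P2]. On
    each section [chi2_le_sqr] gives g^2 <= [K2] h, which feeds the inequality for [P1] and [Q1]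
    applied to g. *)
Lemma chi2_le_prod d1 d2 (T1 : measurableType d1) (T2 : measurableType d2)
    (P1 Q1 : probability T1 R) (P2 Q2 : probability T2 R) (K1 K2 : R) :
  (0 < K2)%R -> chi2_le P1 Q1 K1 -> chi2_le P2 Q2 K2 ->
  chi2_le (P1 \x P2) (Q1 \x Q2) (K1 * K2).
Proof.
move=> K20 H1 H2 f mf f0; have mff := emeasurable_funM mf mf.
have ff0 x : 0 <= f x * f x by exact: mule_ge0.
rewrite !fubini_tonelli1//.
set g := fubini_F Q2 f; set h := fubini_F P2 _.
have mg : measurable_fun setT g by exact: measurable_fun_fubini_tonelli_F.
have mh : measurable_fun setT h by exact: measurable_fun_fubini_tonelli_F.
have g0 x : 0 <= g x by apply: integral_ge0.
have h0 x : 0 <= h x by apply: integral_ge0.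
have gh x : g x * g x <= K2%:E * h x.
  apply: (chi2_le_sqr (f := fun y => f (x, y)) H2 K20) => //.
  exact: measurableT_comp.
have K2V0 : (0 <= K2^-1)%R by rewrite invr_ge0 ltW.
(* With scale 1 / [K2], multiplying by [K2] restores the factor 2 on the left and leaves g^2 / [K2]
   <= h under the integral on the right. *)
have := chi2_leZ H1 mg g0 K2V0.
move=> /(@lee_wpmul2l _ K2%:E); rewrite lee_fin (ltW K20) => /(_ isT).
rewrite muleA -EFinM mulrCA divff ?gt_eqF// mulr1 => /le_trans; apply.
rewrite muleDr//; last first.
  by rewrite fin_num_adde_defl.
rewrite muleA -!EFinM mulrA divff ?gt_eqF// mul1r (mulrC K1) leeD2r//.
rewrite -ge0_integralZl//; last first.
- by move=> x _; exact: mule_ge0.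
- exact: emeasurable_funM.
apply: ge0_le_integral => //.
- by move=> x _; rewrite !mule_ge0// lee_fin.
- by apply: measurable_funeM; exact: emeasurable_funM.
move=> x _; rewrite -[leRHS]mul1e -(divff (lt0r_neq0 K20)) mulrC EFinM -muleA.
by apply: lee_wpmul2l.
Qed.

Lemma chi2_le_distribution d1 d2 (T1 : measurableType d1)
    (T2 : measurableType d2) (P Q : probability T1 R) (K : R)
    (phi : {mfun T1 >-> T2}) :
  chi2_le P Q K -> chi2_le (distribution P phi) (distribution Q phi) K.
Proof.
move=> PQ f mf f0; rewrite /distribution !ge0_integral_pushforward//=.
- by apply: PQ => //; exact: measurableT_comp.
- exact: emeasurable_funM.
- by move=> x _; exact: mule_ge0.
Qed.

Lemma chi2_le_dirac d (T : measurableType d) (a : T) :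
  chi2_le (\d_a : probability T R) \d_a 1.
Proof.
move=> f mf f0; rewrite !integral_dirac//; last exact: emeasurable_funM.
rewrite diracT !mul1e; have := f0 a; case: (f a) => [x| |]//.
  by move=> _; rewrite -!EFinM -EFinD lee_fin; have := sqr_ge0 (x - 1)%R; nra.
by move=> _; rewrite mulyy addye// leey.
Qed.

Lemma chi2_le_iid d (T : measurableType d) (P Q : probability T R) (K : R) n :
  (0 < K)%R -> chi2_le P Q K -> chi2_le (iid P n) (iid Q n) (K ^+ n).
Proof.
move=> K0 PQ; elim: n => [|n IHn] /=; first exact: chi2_le_dirac.
rewrite exprS; apply: chi2_le_distribution.
by apply: chi2_le_prod => //; exact: exprn_gt0.
Qed.

(* Test the inequality on twice the indicator of B. *)
Lemma chi2_le_probability d (T : measurableType d) (P Q : probability T R)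
    (K : R) B : chi2_le P Q K -> measurable B ->
  Q B <= P B + (K / 4)%:E.
Proof.
move=> PQ mB.
have mf : measurable_fun setT (fun x => (\1_B x : R)%:E).
  by apply/measurable_EFinP; exact: measurable_indic.
have f0 x : 0 <= (\1_B x : R)%:E by rewrite lee_fin.
have := chi2_leZ PQ mf f0 (ler0n _ 2).
have ff x : (\1_B x : R)%:E * (\1_B x)%:E = (\1_B x)%:E.
  by rewrite -EFinM indicE; case: (_ \in _); rewrite ?mulr1 ?mulr0.
under [X in _ <= _ * X + _ -> _]eq_integral do rewrite ff.
rewrite !integral_indic// !setIT.
have fin (p q : \bar R) : p \is a fin_num -> q \is a fin_num ->
    (2 * 2)%:E * q <= (2 * 2)%:E * p + K%:E -> q <= p + (K / 4)%:E.
  case: p q => [p| |]// [q| |]// _ _.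
  by rewrite -!EFinM -!EFinD !lee_fin; lra.
exact: fin (fin_num_measure P B mB) (fin_num_measure Q B mB).
Qed.
End chi2.

(** * Gaussian laws: densities, translation, chi-square bound *)

Section gaussian_shift.
Local Open Scope ereal_scope.
Context {R : realType}.
Notation mu := (@lebesgue_measure R).

(** The Radon-Nikodym derivative and [normal_pdf] have the same integral over every measurable set,
    hence agree almost everywhere. *)
Lemma ge0_integral_normal_prob (m s : R) (f : R -> \bar R) :
  measurable_fun setT f -> (forall x, 0 <= f x) ->
  \int[normal_prob m s]_x f x = \int[mu]_x (f x * (normal_pdf m s x)%:E).
Proof.
move=> mf f0; have dom := normal_prob_dominates m s.
have mpdf : measurable_fun setT (fun x => (normal_pdf m s x)%:E).
  by apply/measurable_EFinP; exact: measurable_normal_pdf.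
rewrite -(Radon_Nikodym_SigmaFinite.change_of_variables dom)//.
have iRN : mu.-integrable setT _ := Radon_Nikodym_SigmaFinite.f_integrable dom.
apply: ae_eq_integral => //.
- by apply: emeasurable_funM => //; exact: (measurable_int mu).
- exact: emeasurable_funM.
apply: ae_eqe_mul2l; apply: integral_ae_eq => // A _ mA.
exact: esym (Radon_Nikodym_SigmaFinite.f_integral dom mA).
Qed.

(** By uniqueness of Lebesgue measure, half-open intervals suffice; their preimages have the same
    length. *)
Lemma lebesgue_measure_shift (a : R) (A : set R) : measurable A ->
  pushforward mu (+%R a : _ -> measurableTypeR R) A = mu A.
Proof.
move=> mA; have mS : measurable_fun setT (+%R a : _ -> measurableTypeR R).
  exact: measurable_funD.
apply/esym/lebesgue_measure_unique => //= _ [[x y]] _ <-.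
rewrite /pushforward.
rewrite (_ : _ @^-1` _ = `](x - a)%R, (y - a)%R]%classic); last first.
  apply/seteqP; split => z /=; rewrite !in_itv/= => /andP[? ?];
  by apply/andP; split; lra.
rewrite !lebesgue_measure_itv/= !lte_fin ltrD2r.
by case: ifP => // _; rewrite -!EFinB; congr (_%:E); lra.
Qed.

Lemma ge0_integral_shift (a : R) (f : R -> \bar R) :
  measurable_fun setT f -> (forall x, 0 <= f x) ->
  \int[mu]_x f (a + x)%R = \int[mu]_x f x.
Proof.
move=> mf f0.
have mS : measurable_fun setT (+%R a : _ -> measurableTypeR R).
  exact: measurable_funD.
transitivity (\int[pushforward mu (+%R a : _ -> measurableTypeR R)]_x f x).
  by rewrite ge0_integral_pushforward.
by apply: eq_measure_integral => A mA _; exact: lebesgue_measure_shift.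
Qed.

Lemma normal_pdf_shift (a s x : R) : s != 0%R ->
  normal_pdf a s (a + x) = normal_pdf 0 s x.
Proof.
move=> s0; rewrite !normal_pdfE// normal_fun_center/=.
congr (_ * normal_fun _ _ _)%R.
by rewrite /=; lra.
Qed.

(** Turns the centred noise added by [observe] into a Gaussian centred at the observed entry. *)
Lemma ge0_integral_normal_shift (a s : R) (f : R -> \bar R) : s != 0%R ->
  measurable_fun setT f -> (forall x, 0 <= f x) ->
  \int[normal_prob 0 s]_x f (a + x)%R = \int[normal_prob a s]_x f x.
Proof.
move=> s0 mf f0.
have mfa : measurable_fun setT (fun x => f (a + x)%R).
  by apply: measurableT_comp => //; exact: measurable_funD.
have fa0 x : 0 <= f (a + x)%R by [].
apply: etrans (ge0_integral_normal_prob 0 s mfa fa0) _.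
apply: etrans _ (esym (ge0_integral_normal_prob a s mf f0)).
rewrite -[RHS](ge0_integral_shift a); first last.
- by move=> x; rewrite mule_ge0// lee_fin normal_pdf_ge0.
- apply: emeasurable_funM => //.
  by apply/measurable_EFinP; exact: measurable_normal_pdf.
by apply: eq_integral => x _; rewrite normal_pdf_shift.
Qed.

(** The centres a and 2b - a are symmetric about b, so (x - a)^2 + (x - (2b - a))^2 = 2 (x - b)^2 +
    2 (a - b)^2. *)
Lemma normal_pdf_sqr (a b s x : R) : s != 0%R ->
  (normal_pdf b s x ^+ 2 = expR ((a - b) ^+ 2 / s ^+ 2) *
     (normal_pdf a s x * normal_pdf (2 * b - a) s x))%R.
Proof.
move=> s0; rewrite !normal_pdfE// /normal_fun.
transitivity (normal_peak s ^+ 2 * expR (- (x - b) ^+ 2 / (s ^+ 2 *+ 2)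
    - (x - b) ^+ 2 / (s ^+ 2 *+ 2)))%R.
  by rewrite mulNr expRD; ring.
rewrite (_ : (- (x - b) ^+ 2 / (s ^+ 2 *+ 2) - (x - b) ^+ 2 / (s ^+ 2 *+ 2) =
    (a - b) ^+ 2 / s ^+ 2 + (- (x - a) ^+ 2 / (s ^+ 2 *+ 2)
    + - (x - (2 * b - a)) ^+ 2 / (s ^+ 2 *+ 2)))%R); last by field.
by rewrite !expRD; ring.
Qed.

(* With c = 2b - a, the densities satisfy p_b^2 = exp((a-b)^2/s^2) p_a p_c
   (normal_pdf_sqr), so the integrands are compared pointwise by AM-GM. *)
Lemma chi2_le_normal (a b s : R) : s != 0%R ->
  chi2_le (normal_prob a s) (normal_prob b s) (expR ((a - b) ^+ 2 / s ^+ 2)).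
Proof.
move=> s0 f mf f0; have mff := emeasurable_funM mf mf.
have ff0 x : 0 <= f x * f x by exact: mule_ge0.
have mpdf m : measurable_fun setT
    (fun x : measurableTypeR R => (normal_pdf m s x)%:E).
  by apply/measurable_EFinP; exact: measurable_normal_pdf.
have pdf0 m x : 0 <= (normal_pdf m s x)%:E by rewrite lee_fin normal_pdf_ge0.
set K := expR _; have K0 : (0 <= K)%R by exact: expR_ge0.
rewrite (ge0_integral_normal_prob a s mff ff0).
rewrite (ge0_integral_normal_prob b s mf f0).
have mfp : measurable_fun setT
    (fun x : measurableTypeR R => f x * (normal_pdf b s x)%:E).
  exact: emeasurable_funM.
have mffp : measurable_fun setT
    (fun x : measurableTypeR R => f x * f x * (normal_pdf a s x)%:E).
  exact: emeasurable_funM.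
have mKp := measurable_funeM K%:E (mpdf (2 * b - a)%R).
(* The constant K becomes K times the integral of p_c, so that both sides are Lebesgue integrals. *)
rewrite -[K%:E]mule1 -(integral_normal_pdf (2 * b - a) s).
rewrite -ge0_integralZl//; last by move=> x _; exact: mule_ge0.
rewrite -ge0_integralZl// -ge0_integralD//; first last.
- by move=> x _; exact: mule_ge0.
- by move=> x _; exact: mule_ge0.
apply: ge0_le_integral => //.
- by move=> x _; rewrite !mule_ge0.
- exact: measurable_funeM.
- exact: emeasurable_funD.
move=> x _; have pa0 : (0 < normal_pdf a s x)%R.
  by rewrite normal_pdfE// mulr_gt0 ?normal_peak_gt0// expR_gt0.
have pc0 : (0 < normal_pdf (2 * b - a) s x)%R.
  by rewrite normal_pdfE// mulr_gt0 ?normal_peak_gt0// expR_gt0.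
have := normal_pdf_ge0 b s x; have := normal_pdf_sqr a b x s0; rewrite -/K.
move: (normal_pdf a s x) (normal_pdf b s x) (normal_pdf (2 * b - a) s x) pa0 pc0.
move=> pa pb pc pa0 pc0 pbE pb0.
have := f0 x; case: (f x) => [y| |]//; last first.
  have pay : +oo * pa%:E = +oo by rewrite gt0_mulye ?lte_fin.
  by move=> _; rewrite mulyy pay addye// leey.
rewrite lee_fin => y0; rewrite -!EFinM -EFinD lee_fin.
(* After multiplication by p_a, the last term K p_a p_c is p_b^2 and the square is complete. *)
by rewrite -(ler_pM2r pa0); have := sqr_ge0 (y * pa - pb)%R; nra.
Qed.
End gaussian_shift.

(** * Chi-square bounds for mixtures *)

Section mixture.
Local Open Scope ereal_scope.

(** For fixed f the integrals are linear in the measures: the inequalities for f composed with each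
    [g i] are summed with weight [w]. *)
Lemma chi2_le_mixture (R : realType) d1 d2 (T1 : measurableType d1)
    (T2 : measurableType d2) (P Q : {measure set T2 -> \bar R}) (I : finType)
    (p q : I -> {measure set T1 -> \bar R}) (g : I -> T1 -> T2) (w : R)
    (K : I -> R) : (0 <= w)%R -> (forall i, measurable_fun setT (g i)) ->
  (forall f, measurable_fun setT f -> (forall x, 0 <= f x) ->
    \int[P]_x f x = \sum_i w%:E * \int[p i]_y f (g i y)) ->
  (forall f, measurable_fun setT f -> (forall x, 0 <= f x) ->
    \int[Q]_x f x = \sum_i w%:E * \int[q i]_y f (g i y)) ->
  (forall i, chi2_le (p i) (q i) (K i)) -> chi2_le P Q (w * \sum_i K i).
Proof.
move=> w0 mg intP intQ pq f mf f0; have mff := emeasurable_funM mf mf.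
have ff0 x : 0 <= f x * f x by exact: mule_ge0.
rewrite intP// intQ// big_distrr/= -sumEFin -big_split/=.
rewrite ge0_sume_distrr; last first.
  by move=> i _; rewrite mule_ge0// integral_ge0.
apply: lee_sum => i _; have mfg := measurableT_comp mf (mg i).
have := pq i _ mfg (fun y => f0 _).
move=> /(@lee_wpmul2l _ w%:E); rewrite lee_fin => /(_ w0).
have D y : w%:E * (y + (K i)%:E) = w%:E * y + (w * K i)%:E.
  by rewrite muleDr// fin_num_adde_defl.
by rewrite (muleCA w%:E) D.
Qed.
End mixture.

(** * The law of one observation as a Gaussian mixture over matrix entries *)

Section observation.
Local Open Scope ereal_scope.
Context {R : realType} (m1 m2 : nat).
Hypotheses (m1_gt0 : (0 < m1)%N) (m2_gt0 : (0 < m2)%N).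

Let site (jk : 'I_m1 * 'I_m2) : 'M[R]_(m1, m2) :=
  canonical_vec jk.1 *m (canonical_vec jk.2)^T.

Lemma siteE jk : site jk = delta_mx jk.1 jk.2.
Proof. by rewrite /site /canonical_vec trmx_delta mul_delta_mx. Qed.

Lemma mxtrace_site jk (A : 'M[R]_(m1, m2)) :
  \tr ((site jk)^T *m A) = A jk.1 jk.2.
Proof.
rewrite siteE trmx_delta /mxtrace (bigD1 jk.2)//= big1 ?addr0; last first.
  move=> k /negbTE kjk; rewrite mxE big1// => j _.
  by rewrite mxE kjk mul0r.
rewrite mxE (bigD1 jk.1)//= big1 ?addr0 ?mxE ?eqxx ?mul1r//.
by move=> j /negbTE jjk; rewrite mxE jjk andbF mul0r.
Qed.

(** The m1 m2 sites are distinct and each has mass 1 / (m1 m2), so the complement of their union is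
    negligible. *)
Lemma ge0_integral_uniform_design (f : 'M[R]_(m1, m2) -> \bar R) :
  measurable_fun setT f -> (forall x, 0 <= f x) ->
  \int[uniform_design m1 m2]_x f x =
  \sum_(jk : 'I_m1 * 'I_m2) (m1 * m2)%:R^-1%:E * f (site jk).
Proof.
move=> mf f0.
have ms jk : measurable [set site jk] by exact: measurable_mx1.
have ts : trivIset [set` index_enum ('I_m1 * 'I_m2)%type]
    (fun jk => [set site jk]).
  move=> [j k] [j' k'] _ _ [_ [-> /=]]; rewrite !siteE => /matrixP/(_ j k).
  rewrite !mxE !eqxx /=.
  by case: eqVneq => [->|_]; case: eqVneq => [->|_] //= /eqP; rewrite oner_eq0.
have intD (g : 'M[R]_(m1, m2) -> \bar R) : measurable_fun setT g ->
    (forall x, 0 <= g x) ->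
    \int[uniform_design m1 m2]_(x in \big[setU/set0]_jk [set site jk]) g x =
    \sum_jk (m1 * m2)%:R^-1%:E * g (site jk).
  move=> mg g0; rewrite ge0_integral_bigsetU//=; last 2 first.
  - exact: index_enum_uniq.
  - exact: measurable_funTS.
  apply: eq_bigr => jk _.
  rewrite (eq_integral (cst (g (site jk)))); last first.
    by move=> x; rewrite inE => ->.
  by rewrite integral_cst// [X in _ * X]uniform_designE muleC.
have mD : measurable (\big[setU/set0]_jk [set site jk]).
  by apply: bigsetU_measurable.
have D1 : uniform_design m1 m2 (\big[setU/set0]_jk [set site jk]) = 1.
  rewrite -[LHS]mul1e -integral_cst// intD//.
  under eq_bigr do rewrite mule1.
  rewrite sumEFin sumr_const card_prod !card_ord -[X in X%:E]mulr_natl divff//.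
  by rewrite pnatr_eq0 muln_eq0 negb_or -!lt0n m1_gt0.
rewrite -intD//.
rewrite (ge0_negligible_integral (N := ~` \big[setU/set0]_jk [set site jk]))//.
- by rewrite setDE setCK setTI.
- exact: measurableC.
- have := probability_setC (uniform_design m1 m2) mD.
  by rewrite D1 subee.
Qed.

Lemma ge0_integral_observation_law (A : 'M[R]_(m1, m2)) (s : R)
    (f : 'M[R]_(m1, m2) * R -> \bar R) :
  s != 0%R -> measurable_fun setT f -> (forall x, 0 <= f x) ->
  \int[observation_law A s]_x f x = \sum_(jk : 'I_m1 * 'I_m2)
    (m1 * m2)%:R^-1%:E * \int[normal_prob (A jk.1 jk.2) s]_y f (site jk, y).
Proof.
move=> s0 mf f0; rewrite /observation_law /distribution.
rewrite ge0_integral_pushforward//=.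
have mfo : measurable_fun setT (f \o observe A) by exact: measurableT_comp.
have fo0 p : 0 <= (f \o observe A) p by exact: f0.
rewrite (@fubini_tonelli1 _ _ _ _ _ (uniform_design m1 m2) (normal_prob 0 s)
  (f \o observe A) mfo fo0).
have mF := @measurable_fun_fubini_tonelli_F _ _ _ _ _ (normal_prob 0 s)
  (f \o observe A) mfo fo0.
have F_site jk : fubini_F (normal_prob 0 s) (f \o observe A) (site jk) =
    \int[normal_prob (A jk.1 jk.2) s]_y f (site jk, y).
  have mfs : measurable_fun setT (fun y => f (site jk, y)).
    exact: measurableT_comp.
  rewrite -(ge0_integral_normal_shift _ s0 mfs)//.
  by apply: eq_integral => y _; rewrite /= /observe /= mxtrace_site.
rewrite (ge0_integral_uniform_design mF); last by move=> x; exact: integral_ge0.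
by apply: eq_bigr => jk _; rewrite F_site.
Qed.

Lemma chi2_le_observation_law (A B : 'M[R]_(m1, m2)) (s : R) : s != 0%R ->
  chi2_le (observation_law A s) (observation_law B s)
    ((m1 * m2)%:R^-1 *
     \sum_(jk : 'I_m1 * 'I_m2) expR ((A jk.1 jk.2 - B jk.1 jk.2) ^+ 2 / s ^+ 2)).
Proof.
move=> s0; have w0 : (0 <= (m1 * m2)%:R^-1 :> R)%R by rewrite invr_ge0.
apply: (@chi2_le_mixture R _ _ (measurableTypeR R) _ (observation_law A s)
  (observation_law B s) _ (fun jk => normal_prob (A jk.1 jk.2) s)
  (fun jk => normal_prob (B jk.1 jk.2) s) (fun jk y => (site jk, y)) _
  (fun jk => expR ((A jk.1 jk.2 - B jk.1 jk.2) ^+ 2 / s ^+ 2)) w0).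
- by move=> jk; exact: pair1_measurable.
- move=> f mf f0; exact: (ge0_integral_observation_law A s0 mf f0).
- move=> f mf f0; exact: (ge0_integral_observation_law B s0 mf f0).
- by move=> jk; exact: chi2_le_normal.
Qed.
End observation.

(** * Two-point bound and Assouad's lemma *)

Section assouad.
Context {R : realType}.

(** Passing from Q to P costs E at most K / 4 <= 1/2 in probability, while Q E + Q E' >= 1 by the
    covering. *)
Lemma chi2_le_two_point d (T : measurableType d) (P Q : probability T R)
    (K : R) (E E' : set T) :
  chi2_le P Q K -> K <= 2 -> measurable E -> measurable E' ->
  E `|` E' = setT -> 2^-1 <= fine (P E) + fine (Q E').
Proof.
move=> PQ K2 mE mE' EE'.
have H1 : (Q E <= P E + (K / 4)%:E)%E by exact: chi2_le_probability.
have H2 : (1 <= Q E + Q E')%E.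
  by rewrite -(probability_setT Q) -EE' measureU2.
have {}H1 : fine (Q E) <= fine (P E) + K / 4.
  by rewrite -lee_fin EFinD !fineK ?fin_num_measure.
have {}H2 : 1 <= fine (Q E) + fine (Q E').
  by rewrite -lee_fin EFinD !fineK ?fin_num_measure.
lra.
Qed.

(** By contradiction: the expected number of wrong coordinates, summed over [W], would be both below
    and at least |W| |S| / 4. *)
Lemma assouad d (T : measurableType d) (W S : finType) (w0 : W) (s0 : S)
    (P : W -> probability T R) (K : R) (flip : S -> W -> W)
    (wrong : S -> W -> set T) (far : W -> set T) :
  K <= 2 -> (forall s, involutive (flip s)) ->
  (forall s w, chi2_le (P w) (P (flip s w)) K) ->
  (forall s w, measurable (wrong s w)) -> (forall w, measurable (far w)) ->
  (forall s w, wrong s w `|` wrong s (flip s w) = setT) ->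
  (forall w z, ~ far w z -> \sum_s \1_(wrong s w) z <= #|S|%:R / 8 :> R) ->
  exists w, (8^-1%:E <= P w (far w))%E.
Proof.
move=> K2 flipK PK mw mf cover sparse; apply: contrapT => noW.
have {}noW w : fine (P w (far w)) < 8^-1.
  rewrite -lte_fin fineK ?fin_num_measure// ltNge; apply/negP => h.
  by apply: noW; exists w.
have S0 : 0 < #|S|%:R :> R by rewrite ltr0n; apply/card_gt0P; exists s0.
have W0 : 0 < #|W|%:R :> R by rewrite ltr0n; apply/card_gt0P; exists w0.
(* Off [far w] at most |S| / 8 coordinates are wrong; on it possibly all |S|, but its probability is
   below 1/8. *)
have upper w : \sum_s fine (P w (wrong s w)) < #|S|%:R / 4.
  suff H : \sum_s fine (P w (wrong s w)) <=
      #|S|%:R / 8 + #|S|%:R * fine (P w (far w)).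
    apply: (le_lt_trans H); have := noW w; rewrite -(ltr_pM2l S0); lra.
  rewrite -lee_fin -sumEFin EFinD (EFinM _ (fine _)) fineK ?fin_num_measure//.
  have -> : (\sum_s (fine (P w (wrong s w)))%:E =
      \int[P w]_z \sum_s (\1_(wrong s w) z)%:E)%E.
    rewrite ge0_integral_sum//; last first.
      by move=> s; apply/measurable_EFinP; exact: measurable_indic.
    apply: eq_bigr => s _.
    by rewrite integral_indic// setIT fineK ?fin_num_measure.
  have mfar : measurable_fun setT (fun z => (\1_(far w) z : R)%:E).
    by apply/measurable_EFinP; exact: measurable_indic.
  have -> : ((#|S|%:R / 8)%:E + #|S|%:R%:E * P w (far w) =
      \int[P w]_z ((#|S|%:R / 8)%:E + #|S|%:R%:E * (\1_(far w) z)%:E))%E.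
    rewrite ge0_integralD//; last exact: measurable_funeM.
    have PT : P w setT = 1%E by exact: probability_setT.
    rewrite integral_cst// [X in (_ * X + _)%E]PT mule1 ge0_integralZl//.
    by rewrite integral_indic// setIT.
  apply: ge0_le_integral => //.
  - by move=> z _; apply: sume_ge0 => s _; rewrite lee_fin.
  - apply: emeasurable_sum => s; apply/measurable_EFinP.
    exact: measurable_indic.
  - by apply: emeasurable_funD => //; exact: measurable_funeM.
  move=> z _; rewrite sumEFin -EFinM -EFinD lee_fin [\1_(far w) z]indicE.
  have [zin|znotin] := boolP (z \in far w).
    rewrite mulr1 (@le_trans _ _ #|S|%:R)//; last by rewrite lerDr divr_ge0// ltW.
    rewrite -sum1_card natr_sum ler_sum// => s _.
    by rewrite indicE; case: (_ \in _).
  rewrite mulr0 addr0; apply: sparse => fz.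
  by move/negP: znotin; apply; rewrite inE.
(* Reindexing by the involution [flip s] counts the sum twice, as pairs that each contribute at
   least 1/2. *)
have lower s : #|W|%:R / 4 <= \sum_w fine (P w (wrong s w)).
  have E : \sum_w fine (P w (wrong s w)) =
      \sum_w fine (P (flip s w) (wrong s (flip s w))).
    by rewrite (reindex_inj (can_inj (flipK s))).
  have : #|W|%:R / 2 <= \sum_w (fine (P w (wrong s w)) +
      fine (P (flip s w) (wrong s (flip s w)))).
    rewrite -sum1_card natr_sum mulr_suml ler_sum// => w _; rewrite mul1r.
    by apply: chi2_le_two_point (PK s w) K2 _ _ (cover s w).
  by rewrite big_split/= -E; lra.
have : \sum_w \sum_s fine (P w (wrong s w)) < #|W|%:R * (#|S|%:R / 4).
  rewrite mulr_natl -sumr_const; apply: ltr_sum => //.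
  by apply/hasP; exists w0; rewrite ?mem_index_enum.
rewrite exchange_big/= ltNge => /negP; apply.
rewrite mulrA mulrAC mulrC mulr_natl -sumr_const.
by apply: ler_sum => s _; exact: lower.
Qed.
End assouad.

(** * Sign matrices and the lower bound for a fixed estimator *)

(* N stands for max(m1, m2) r, and phi for the cell of the sign pattern that
   determines a given entry. *)
Section lower_bound.
Context {R : realType} (m1 m2 n N : nat) (I : finType)
  (phi : 'I_m1 * 'I_m2 -> I) (a sigma : R).
Hypotheses (m1_gt0 : (0 < m1)%N) (m2_gt0 : (0 < m2)%N) (N_gt0 : (0 < N)%N)
  (N_le_n : (N <= n)%N) (a_gt0 : 0 < a) (sigma_gt0 : 0 < sigma).
Hypothesis fibre : forall k, (#|[pred t | phi t == k]| * N <= 2 * (m1 * m2))%N.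

Definition amplitude : R := 8^-1 * Num.min sigma a * Num.sqrt (N%:R / n%:R).
Local Notation gamma := amplitude.

Definition sign_matrix (w : {ffun I -> bool}) : 'M[R]_(m1, m2) :=
  \matrix_(i, j) (if w (phi (i, j)) then gamma else - gamma).

(** Coordinates are matrix entries rather than cells, so that the number of wrong ones compares
    directly with the Frobenius norm. Entries of one cell share the same flip. *)
Let flip (s : 'I_m1 * 'I_m2) (w : {ffun I -> bool}) : {ffun I -> bool} :=
  [ffun k => if k == phi s then ~~ w k else w k].

Let min_gt0 : 0 < Num.min sigma a.
Proof. by rewrite lt_min sigma_gt0. Qed.

Let n_gt0 : 0 < n%:R :> R.
Proof. by rewrite ltr0n (leq_trans N_gt0). Qed.

Let NR_gt0 : 0 < N%:R :> R.
Proof. by rewrite ltr0n. Qed.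

Let ratio_gt0 : 0 < N%:R / n%:R :> R.
Proof. exact: divr_gt0. Qed.

Let ratio_le1 : N%:R / n%:R <= 1 :> R.
Proof. by rewrite ler_pdivrMr// mul1r ler_nat. Qed.

Let gamma_gt0 : 0 < gamma.
Proof. by rewrite /amplitude !mulr_gt0// sqrtr_gt0. Qed.

Let gamma_sqr : gamma ^+ 2 = 64^-1 * Num.min sigma a ^+ 2 * (N%:R / n%:R).
Proof. by rewrite /amplitude !exprMn sqr_sqrtr ?ltW//; field; rewrite gt_eqF. Qed.

Lemma sign_matrix_bounded w i j : `|sign_matrix w i j| <= a.
Proof.
have -> : `|sign_matrix w i j| = gamma.
  by rewrite mxE; case: ifP => _; rewrite ?normrN gtr0_norm.
have min_le : Num.min sigma a <= a by rewrite ge_min lexx orbT.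
have sqrt_le : Num.sqrt (N%:R / n%:R) <= 1 :> R.
  by rewrite -[leRHS]sqrtr1 ler_wsqrtr.
have := sqrtr_ge0 (N%:R / n%:R : R).
have : 0 <= Num.min sigma a by exact: ltW.
rewrite /amplitude; nra.
Qed.

Let chi2_bound s w : ((m1 * m2)%:R^-1 * \sum_(jk : 'I_m1 * 'I_m2)
  expR ((sign_matrix w jk.1 jk.2 - sign_matrix (flip s w) jk.1 jk.2) ^+ 2 /
        sigma ^+ 2)) ^+ n <= 2.
Proof.
set A := sign_matrix w; set B := sign_matrix _.
(* A flipped entry moves by 2 [gamma], so x is its exponent in the Gaussian bound. *)
set x : R := 4 * gamma ^+ 2 / sigma ^+ 2.
have m_gt0 : 0 < (m1 * m2)%:R :> R by rewrite ltr0n muln_gt0 m1_gt0.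
have x_ge0 : 0 <= x.
  exact: divr_ge0 (mulr_ge0 (ler0n _ 4) (sqr_ge0 _)) (sqr_ge0 _).
have x_le : x <= 16^-1 * (N%:R / n%:R).
  rewrite /x ler_pdivrMr ?exprn_gt0// gamma_sqr.
  have min_le : Num.min sigma a <= sigma by rewrite ge_min lexx.
  have : Num.min sigma a ^+ 2 <= sigma ^+ 2.
    by apply: lerXn2r => //; rewrite nnegrE ltW.
  rewrite -(ler_pM2r ratio_gt0); lra.
(* From 1 - x <= exp(-x) comes exp(x) - 1 <= x exp(x), and exp(x) <= 2 since x <= 1/16. *)
have expx : expR x - 1 <= 8^-1 * (N%:R / n%:R).
  have e1 : expR x * (1 - x) <= 1.
    by rewrite -[leRHS](expRxMexpNx_1 x) ler_pM2l ?expR_gt0// expR_ge1Dx.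
  have x16 : x <= 16^-1 by have := ratio_le1; lra.
  have y2 : expR x <= 2 by have := expR_gt0 x; nra.
  have xy : x * expR x <= x * 2 by exact: ler_wpM2l.
  lra.
have entry jk : expR ((A jk.1 jk.2 - B jk.1 jk.2) ^+ 2 / sigma ^+ 2) =
    1 + (phi jk == phi s)%:R * (expR x - 1).
  rewrite /A /B !mxE ffunE -surjective_pairing.
  have [_|_] := eqVneq (phi jk) (phi s); last first.
    by rewrite subrr expr0n mul0r expR0 mul0r addr0.
  rewrite mul1r [RHS]addrC subrK; congr expR; rewrite /x; congr (_ / _).
  by case: (w _) => /=; ring.
have -> : \sum_jk expR ((A jk.1 jk.2 - B jk.1 jk.2) ^+ 2 / sigma ^+ 2) =
    (m1 * m2)%:R + #|[pred t | phi t == phi s]|%:R * (expR x - 1).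
  rewrite (eq_bigr _ (fun jk _ => entry jk)) big_split/= -mulr_suml.
  congr (_ + _ * _); first by rewrite sumr_const card_prod !card_ord.
  rewrite -sum1_card natr_sum [RHS]big_mkcond/=.
  by apply: eq_bigr => t _; rewrite inE; case: eqP.
set F : R := #|_|%:R.
have FN : F * N%:R <= 2 * (m1 * m2)%:R.
  by rewrite /F -!natrM ler_nat fibre.
(* The flipped fraction of entries is at most 2 / N, so one observation costs at most 1 + (2 / N) (N
   / (8 n)) = 1 + 1 / (4 n). The n-th power is then at most exp(1/4) <= 4/3. *)
have K_le : (m1 * m2)%:R^-1 * ((m1 * m2)%:R + F * (expR x - 1)) <=
    expR (4^-1 / n%:R).
  apply: le_trans (expR_ge1Dx _).
  rewrite mulrDr mulVf ?gt_eqF// lerD2l mulrC ler_pdivrMr//.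
  have F0 : 0 <= F by exact: ler0n.
  apply: (@le_trans _ _ (F * (8^-1 * (N%:R / n%:R)))); first exact: ler_wpM2l.
  rewrite -(ler_pM2r n_gt0).
  have -> : F * (8^-1 * (N%:R / n%:R)) * n%:R = 8^-1 * (F * N%:R).
    by field; rewrite gt_eqF.
  have -> : 4^-1 / n%:R * (m1 * m2)%:R * n%:R = 4^-1 * (m1 * m2)%:R :> R.
    by field; rewrite gt_eqF.
  lra.
apply: (@le_trans _ _ (expR (4^-1 / n%:R) ^+ n)).
  apply: lerXn2r => //; rewrite nnegrE ?expR_ge0//.
  rewrite mulr_ge0 ?invr_ge0// addr_ge0// mulr_ge0// subr_ge0.
  by rewrite -expR0 ler_expR.
rewrite -expRM_natl -mulrC divfK ?gt_eqF//.
have : expR (4^-1 : R) * (1 - 4^-1) <= 1.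
  by rewrite -[leRHS](expRxMexpNx_1 (4^-1 : R)) ler_pM2l ?expR_gt0// expR_ge1Dx.
lra.
Qed.

Lemma sign_matrix_lower_bound
    (Ahat : n.-tuple ('M[R]_(m1, m2) * R) -> 'M[R]_(m1, m2)) :
  measurable_fun setT Ahat ->
  exists w, (8^-1%:E <= sample_law (sign_matrix w) sigma n
    [set z | (512^-1 * Num.min sigma a ^+ 2 * (N%:R / n%:R) <
      (m1 * m2)%:R^-1 * frobenius_norm (Ahat z - sign_matrix w) ^+ 2)%R])%E.
Proof.
move=> mAhat.
have mentry i j w : measurable_fun setT
    (fun z => (Ahat z i j - sign_matrix w i j) ^+ 2).
  apply: measurable_funX; apply: measurable_funB => //.
  exact: (measurableT_comp (@measurable_mx_entry _ R m1 m2 i j) mAhat).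
have frobE (A : 'M[R]_(m1, m2)) :
    frobenius_norm A ^+ 2 = \sum_(s : 'I_m1 * 'I_m2) A s.1 s.2 ^+ 2.
  rewrite /frobenius_norm sqr_sqrtr; first by rewrite pair_bigA.
  by apply: sumr_ge0 => i _; apply: sumr_ge0 => j _; exact: sqr_ge0.
pose s0 : 'I_m1 * 'I_m2 := (Ordinal m1_gt0, Ordinal m2_gt0).
have cardS : #|{: 'I_m1 * 'I_m2}| = (m1 * m2)%N by rewrite card_prod !card_ord.
have m_gt0 : 0 < (m1 * m2)%:R :> R by rewrite ltr0n muln_gt0 m1_gt0.
pose wrong (s : 'I_m1 * 'I_m2) w : set (n.-tuple ('M[R]_(m1, m2) * R)) :=
  [set z | gamma ^+ 2 <= (Ahat z s.1 s.2 - sign_matrix w s.1 s.2) ^+ 2].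
pose K s w := (m1 * m2)%:R^-1 * \sum_(jk : 'I_m1 * 'I_m2)
  expR ((sign_matrix w jk.1 jk.2 - sign_matrix (flip s w) jk.1 jk.2) ^+ 2 /
        sigma ^+ 2).
apply: (@assouad R _ _ _ _ [ffun=> true] s0
  (fun w => sample_law (sign_matrix w) sigma n) 2 flip wrong) => //.
- move=> s w; apply/ffunP => k; rewrite !ffunE.
  by case: eqP => // _; rewrite negbK.
- move=> s w f mf f0.
  have K_gt0 : 0 < K s w.
    rewrite mulr_gt0 ?invr_gt0// (bigD1 s0)//= ltr_pwDl ?expR_gt0//.
    by apply: sumr_ge0 => *; exact: expR_ge0.
  have := chi2_le_iid (n := n) K_gt0 (chi2_le_observation_law m1_gt0 m2_gt0
    (sign_matrix w) (sign_matrix (flip s w)) (lt0r_neq0 sigma_gt0)).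
  move=> /(_ f mf f0) /le_trans; apply; rewrite leeD2l// lee_fin.
  exact: chi2_bound.
- move=> s w; rewrite /wrong -[X in measurable X]setTI.
  exact: measurable_fun_ler.
- move=> w; rewrite -[X in measurable X]setTI; apply: measurable_fun_ltr => //.
  under eq_fun do rewrite frobE.
  apply: measurable_funM => //; apply: measurable_sum => s.
  under eq_fun do rewrite !mxE.
  have := mentry s.1 s.2 w.
  by under eq_fun do rewrite !mxE.
- move=> s w; apply/seteqP; split => // z _; rewrite /wrong /=.
  rewrite !mxE -surjective_pairing ffunE eqxx.
  move: (Ahat z s.1 s.2) => y; have := gamma_gt0.
  (* A nonnegative y is at distance at least [gamma] from -[gamma], a negative one from [gamma]. *)
  have [y0|y0] := leP 0 y; case: (w _) => /= sz; [right|left|left|right]; nra.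
(* The threshold is [gamma]^2 / 8, as 512 = 8 * 64. Each wrong entry contributes at least [gamma]^2,
   so at most an eighth of the entries are wrong. *)
move=> w z /negP; rewrite -leNgt frobE cardS => close.
rewrite -(ler_pM2r (exprn_gt0 2 gamma_gt0)) mulr_suml.
have {}close : \sum_(s : 'I_m1 * 'I_m2) (Ahat z - sign_matrix w) s.1 s.2 ^+ 2 <=
    (m1 * m2)%:R / 8 * gamma ^+ 2.
  move: close; rewrite mulrC ler_pdivrMr//.
  by rewrite gamma_sqr; lra.
apply: le_trans close; apply: ler_sum => s _; rewrite indicE.
have [|_] := boolP (z \in wrong s w); last by rewrite mul0r sqr_ge0.
by rewrite inE mul1r /wrong /= !mxE.
Qed.
End lower_bound.

(** * Cell sizes, rank, and the minimax bound *)

(** On a fibre of [phi] the quotient [c t %/ r] determines [t], and it is at most [m %/ r]. In the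
    application [phi] retains the remainder of [c t]. *)
Lemma card_fibre_divn (T J : finType) (m r : nat) (phi : T -> J) (c : T -> 'I_m)
    (k : J) :
  (forall t t', phi t = phi t' -> (c t %/ r)%N = (c t' %/ r)%N -> t = t') ->
  (#|[pred t | phi t == k]| <= (m %/ r).+1)%N.
Proof.
move=> phi_c; pose h t : 'I_(m %/ r).+1 := inord (c t %/ r).
have h_inj : {in [pred t | phi t == k] &, injective h}.
  move=> t t'; rewrite !inE => /eqP tk /eqP t'k /(congr1 val) /=.
  have c_lt u : (c u %/ r < (m %/ r).+1)%N by rewrite ltnS leq_div2r// ltnW.
  by rewrite !inordK//; apply: phi_c; rewrite tk.
by rewrite -(card_in_image h_inj) -[leqRHS]card_ord max_card.
Qed.

(** The possibly incomplete last block is paid for by r <= m; this is the source of the factor 2 in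
    [fibre]. *)
Lemma divnS_mul_le (m r : nat) : (r <= m)%N -> ((m %/ r).+1 * r <= 2 * m)%N.
Proof. by move=> rm; rewrite mulSn mul2n -addnn leq_add// leq_trunc_div. Qed.

Lemma mxrank_colsub_le (F : fieldType) (m p r : nat) (A : 'M[F]_(m, r))
    (g : 'I_p -> 'I_r) : (\rank (colsub g A) <= r)%N.
Proof.
have -> : colsub g A = A *m colsub g 1%:M by rewrite mulmx_colsub mulmx1.
exact: mulmx_max_rank.
Qed.

Theorem theorem6 (R : realType) :
  exists beta c : R, [/\ 0 < beta < 1, 0 < c &
    forall (a sigma : R) (m1 m2 n r : nat),
      0 < a -> 0 < sigma ->
      (1 <= r <= minn m1 m2)%N -> (maxn m1 m2 * r <= n)%N ->
      (beta%:E <= ereal_inf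
         [set ereal_sup
            [set sample_law A0 sigma n
               [set z | (c * Num.min sigma a ^+ 2 *
                          ((maxn m1 m2 * r)%:R / n%:R) <
                        (m1 * m2)%:R^-1 * frobenius_norm (Ahat z - A0) ^+ 2)%R]
            | A0 in bounded_rank_class r a]
         | Ahat in [set f : n.-tuple ('M[R]_(m1, m2) * R) -> 'M[R]_(m1, m2)
                   | measurable_fun setT f]])%E].
Proof.
exists 8^-1, 512^-1; split; [lra|lra|].
move=> a sigma m1 m2 n r a_gt0 sigma_gt0 /andP[r_gt0].
rewrite leq_min => /andP[r_m1 r_m2] Mr_n.
have m1_gt0 := leq_trans r_gt0 r_m1; have m2_gt0 := leq_trans r_gt0 r_m2.
have Mr_gt0 : (0 < maxn m1 m2 * r)%N by rewrite muln_gt0 leq_max m1_gt0.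
apply: le_ereal_inf_tmp => _ [Ahat mAhat <-].
set N := (maxn m1 m2 * r)%N.
(* Only the partition into cells remains to be chosen: small cells for the divergence, few distinct
   columns or rows for the rank. *)
suff [I [phi [fibre rank_le]]] :
    exists (I : finType) (phi : 'I_m1 * 'I_m2 -> I),
    (forall k, (#|[pred t | phi t == k]| * N <= 2 * (m1 * m2))%N) /\
    (forall w, (\rank (sign_matrix n N phi a sigma w) <= r)%N).
  have [w Pw] := sign_matrix_lower_bound m1_gt0 m2_gt0 Mr_gt0 Mr_n a_gt0
    sigma_gt0 fibre mAhat.
  apply: (le_trans Pw); apply: ereal_sup_ubound.
  exists (sign_matrix n N phi a sigma w) => //; split => // i j.
  exact: sign_matrix_bounded.
(* Writing the rank as a successor gives [inord] an inhabited target. *)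
rewrite {}/N; case: r r_gt0 => // r _ in r_m1 r_m2 Mr_n Mr_gt0 *.
pose f m (j : 'I_m) : 'I_r.+1 := inord (j %% r.+1).
have f_inj m (j j' : 'I_m) :
    f m j = f m j' -> (j %/ r.+1 = j' %/ r.+1)%N -> j = j'.
  move=> /(congr1 val); rewrite /f /= !inordK ?ltn_mod// => modE divE.
  by apply: val_inj; rewrite /= (divn_eq j r.+1) divE modE -divn_eq.
(* The index of the larger dimension is kept and that of the smaller one reduced modulo the rank,
   which leaves M r cells. *)
have [m21|m12] := leqP m2 m1.
  exists _, (fun t => (t.1, f m2 t.2)); split => [k|w].
    have /(_ k) F := @card_fibre_divn _ _ m2 r.+1
      (fun t : 'I_m1 * 'I_m2 => (t.1, f m2 t.2)) snd.
    rewrite mulnCA [X in (_ <= X)%N]mulnCA leq_mul2l; apply/orP; right.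
    apply: (leq_trans _ (divnS_mul_le r_m2)); rewrite leq_mul2r F ?orbT//.
    by move=> [i j] [i' j'] /= [-> /f_inj] h /h ->.
  rewrite (_ : sign_matrix _ _ _ _ _ _ =
    colsub (f m2) (\matrix_(i < m1, k < r.+1)
      (if w (i, k) then amplitude n (m1 * r.+1) a sigma
       else - amplitude n (m1 * r.+1) a sigma))).
    exact: mxrank_colsub_le.
  by apply/matrixP => i j; rewrite !mxE.
exists _, (fun t => (f m1 t.1, t.2)); split => [k|w].
  have /(_ k) F := @card_fibre_divn _ _ m1 r.+1
    (fun t : 'I_m1 * 'I_m2 => (f m1 t.1, t.2)) fst.
  rewrite (mulnC m1) mulnCA [X in (_ <= X)%N]mulnCA leq_mul2l; apply/orP; right.
  apply: (leq_trans _ (divnS_mul_le r_m1)); rewrite leq_mul2r F ?orbT//.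
  by move=> [i j] [i' j'] /= [/f_inj h ->] /h ->.
(* Here rows are repeated, and transposition makes them columns. *)
rewrite -mxrank_tr.
rewrite (_ : (sign_matrix _ _ _ _ _ _)^T =
  colsub (f m1) (\matrix_(j < m2, k < r.+1)
    (if w (k, j) then amplitude n (m2 * r.+1) a sigma
     else - amplitude n (m2 * r.+1) a sigma))).
  exact: mxrank_colsub_le.
by apply/matrixP => i j; rewrite !mxE.
Qed.
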